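(* Let $\mathcal{A},\mathcal{B}$ be alphabets, let $x \in \mathcal{A}^{\mathbb{Z}}$ be a bi-infinite word which is eventually weak or neutral, or which is eventually strong or neutral, and let $\sigma : \mathcal{A}^* \to \mathcal{B}^*$ be a non-erasing morphism. Then there exists $C \in \mathbb{Z}$ such that $$p_{\sigma(x)}(n) \leq C + p_x(n)$$ for all $n \geq 0$.
   Context: An alphabet is a finite set of letters (of size at least 2). A morphism $\sigma : \mathcal{A}^* \to \mathcal{B}^*$ is a monoid homomorphism; it is non-erasing if $\sigma(a) \neq \varepsilon$ (the empty word) for all $a \in \mathcal{A}$, and then it extends naturally to bi-infinite words. For $x \in \mathcal{A}^{\mathbb{Z}}$, $\mathcal{L}(x)$ is the set of finite factors of $x$, $\mathcal{L}_n(x)$ and $\mathcal{L}_{\geq n}(x)$ are the sets of factors of length exactly $n$ and at least $n$, and the factor complexity is $p_x(n) = \# \mathcal{L}_n(x)$. For $w \in \mathcal{L}(x)$ define $E^-_x(w) = \{a \mid aw \in \mathcal{L}(x)\}$, $E^+_x(w) = \{b \mid wb \in \mathcal{L}(x)\}$, $E_x(w) = \{(a,b) \mid awb \in \mathcal{L}(x)\}$, and $m_x(w) = \# E_x(w) - \# E^-_x(w) - \# E^+_x(w) + 1$. The word $w$ is neutral (resp., weak, strong) if $m_x(w) = 0$ (resp., $m_x(w)<0$, $m_x(w)>0$). The bi-infinite word $x$ is eventually weak (resp., strong) or neutral if there exists $N \geq 0$ such that every $w \in \mathcal{L}_{\geq N}(x)$ is weak (resp., strong) or neutral, i.e. $m_x(w)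 \le 0$ (resp., $m_x(w) \geq 0$). *)

(* Defs.v *)
From HB Require Import structures.
From mathcomp Require Import all_boot all_order all_algebra.
From mathcomp Require Import boolp.
Set Implicit Arguments.
Unset Strict Implicit.
Unset Printing Implicit Defensive.
Import Order.TTheory GRing.Theory Num.Theory.

Definition biword (A : Type) := int -> A.

Section Languages.
Variables (A : finType) (x : biword A).

(* x_i x_(i+1) ... x_(i+n-1) *)
Definition factor_at (i : int) (n : nat) : seq A :=
  [seq x (i + k%:Z)%R | k <- iota 0 n].

Definition in_lang (w : seq A) : Prop :=
  exists i : int, w = factor_at i (size w).

Definition lang_n (n : nat) : {set n.-tuple A} :=
  [set w : n.-tuple A | `[< in_lang w >]].

Definition complexity (n : nat) : nat := #|lang_n n|.

Definition left_ext (w : seq A) : {set A} :=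
  [set a | `[< in_lang (a :: w) >]].

Definition right_ext (w : seq A) : {set A} :=
  [set b | `[< in_lang (rcons w b) >]].

Definition bi_ext (w : seq A) : {set A * A} :=
  [set ab | `[< in_lang (ab.1 :: rcons w ab.2) >]].

Definition multiplicity (w : seq A) : int :=
  (#|bi_ext w|%:Z - #|left_ext w|%:Z - #|right_ext w|%:Z + 1)%R.

Definition neutral (w : seq A) : Prop := multiplicity w = 0%R.
Definition weak (w : seq A) : Prop := (multiplicity w < 0)%R.
Definition strong (w : seq A) : Prop := (0 < multiplicity w)%R.

Definition eventually_weak_or_neutral : Prop :=
  exists N : nat, forall w : seq A,
    in_lang w -> N <= size w -> weak w \/ neutral w.

Definition eventually_strong_or_neutral : Prop :=
  exists N : nat, forall w : seq A,
    in_lang w -> N <= size w -> strong w \/ neutral w.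

End Languages.

Section Morphisms.
Variables (A B : finType) (sigma : seq A -> seq B).

Definition word_morphism : Prop :=
  sigma [::] = [::] /\ {morph sigma : u v / u ++ v >-> u ++ v}.

Definition non_erasing : Prop := forall a : A, sigma [:: a] <> [::].

Hypotheses (sM : word_morphism) (sN : non_erasing).

Lemma leq_size_morphism (w : seq A) : size w <= size (sigma w).
Proof.
elim: w => [//|a w IH]; rewrite -cat1s sM.2 !size_cat leq_add //.
by case: (sigma [:: a]) (sN (a := a)).
Qed.

Lemma leq_size_image (x : biword A) (i : int) (n : nat) :
  n <= size (sigma (factor_at x i n)).
Proof.
by have := leq_size_morphism (factor_at x i n); rewrite size_map size_iota.
Qed.

Lemma ltn_size_image_rev (x : biword A) (i : int) (n : nat) :
  n < size (rev (sigma (factor_at x i n.+1))).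
Proof. by rewrite size_rev leq_size_image. Qed.

Definition letter (s : seq B) (k : nat) (ks : k < size s) : B :=
  tnth (in_tuple s) (Ordinal ks).

(* ... sigma(x_(-2)) sigma(x_(-1)) . sigma(x_0) sigma(x_1) ...
   with sigma(x_0) starting at position 0.  As sigma is non-erasing, the letter
   at n >= 0 can be read in sigma(x_0 ... x_n), and the letter at
   Negz n = -(n+1) in sigma(x_(-(n+1)) ... x_(-1)), counting from the right. *)
Definition bi_image (x : biword A) : biword B := fun i =>
  match i with
  | Posz n => letter (leq_size_image x 0 n.+1)
  | Negz n => letter (ltn_size_image_rev x (Negz n) n)
  end.

Lemma factor_at_cat (T : finType) (y : biword T) i m n :
  factor_at y i (m + n) = factor_at y i m ++ factor_at y (i + m%:Z)%R n.
Proof.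
rewrite /factor_at iotaD map_cat add0n; congr (_ ++ _).
rewrite -[m in iota m n]addn0 iotaDl -map_comp; apply: eq_map => k /=.
by rewrite PoszD addrA.
Qed.

Lemma bi_image_pos x n : sigma (factor_at x 0 n) =
  factor_at (bi_image x) 0 (size (sigma (factor_at x 0 n))).
Proof.
set s := sigma _; case Es: s => [//|b s']; rewrite -Es.
apply: (@eq_from_nth _ b); first by rewrite size_map size_iota.
move=> k ks; rewrite (nth_map 0) ?size_iota // nth_iota // add0n add0r /=.
rewrite /letter (tnth_nth b) /=.
have [le_kn|/ltnW le_nk] := leqP k.+1 n.
  rewrite /s -(subnKC le_kn) factor_at_cat sM.2 nth_cat.
  by rewrite leq_size_image.
by rewrite -[in RHS](subnKC le_nk) factor_at_cat sM.2 nth_cat -/s ks.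
Qed.

Lemma bi_image_neg x n : let s := sigma (factor_at x (- n%:Z)%R n) in
  s = factor_at (bi_image x) (- (size s)%:Z)%R (size s).
Proof.
move=> s; apply: (can_inj revK).
case Es: s => [//|b s']; rewrite -Es.
apply: (@eq_from_nth _ b); first by rewrite !size_rev size_map size_iota.
move=> k; rewrite size_rev => ks.
rewrite [RHS]nth_rev ?size_map ?size_iota // (nth_map 0) ?size_iota; last first.
  by rewrite ltn_subrL; case: (size s) ks.
rewrite nth_iota ?add0n; last by rewrite ltn_subrL; case: (size s) ks.
have -> : (- (size s)%:Z + (size s - k.+1)%:Z)%R = Negz k.
  by rewrite -subzn // NegzE addrA addNr add0r.
rewrite /= /letter (tnth_nth b) /= NegzE.
have suff_cat m p : sigma (factor_at x (- (m + p)%:Z)%R (m + p)) =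
    sigma (factor_at x (- (m + p)%:Z)%R m) ++ sigma (factor_at x (- p%:Z)%R p).
  by rewrite factor_at_cat sM.2 PoszD opprD addrAC addNr add0r.
have [le_kn|/ltnW le_nk] := leqP k.+1 n.
  rewrite /s -(subnK le_kn) suff_cat rev_cat nth_cat size_rev.
  by rewrite leq_size_image.
by rewrite -[in RHS](subnK le_nk) suff_cat rev_cat nth_cat size_rev -/s ks.
Qed.

Lemma bi_imageE x m n :
  let s := sigma (factor_at x (- m%:Z)%R (m + n)) in
  s = factor_at (bi_image x)
        (- (size (sigma (factor_at x (- m%:Z)%R m)))%:Z)%R (size s).
Proof.
move=> s; rewrite /s factor_at_cat sM.2 size_cat factor_at_cat !addNr.
by rewrite -bi_image_neg -bi_image_pos.
Qed.

End Morphisms.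

(* Main.v *)
Require Import Defs.
From HB Require Import structures.
From mathcomp Require Import all_boot all_order all_algebra.
From mathcomp Require Import boolp.
From mathcomp Require Import zify.

(* Write s(n) = p(n+1) - p(n) for the first difference of the complexity of x;
   s(n) is the sum over the words w of length n of f(w) = #E^+(w) - 1, and the
   multiplicity of w is the sum of f(aw) over the left extensions aw, minus
   f(w).  In the weak case s is eventually nonincreasing, hence constant, so
   that x is even eventually neutral: one may assume m(w) >= 0 for all long w.
   A factor of length n of sigma(x) is determined by a pair (k, w): an offset k
   in the image of a letter and the shortest word w from that letter on whose
   image covers the factor.  When n grows by one, the number of such pairs grows
   by the sum of f over the words w with |sigma(w)| = n + k.  These are of length
   at most n, and none is a suffix of another.  For long words, m >= 0 bounds
   f(w) by the sum of f(aw), hence by the sum of f over the words of length n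
   ending in w, so the growth is at most s(n). *)

Set Implicit Arguments.
Unset Strict Implicit.
Unset Printing Implicit Defensive.
Import Order.TTheory GRing.Theory Num.Theory.

(** After exchanging the sums, each [j] is counted for at most one [i]. *)
Lemma leq_sum_disjoint (I J : eqType) (s : seq I) (r : seq J)
    (P : I -> J -> bool) (F : J -> nat) :
  uniq s ->
  {in s &, forall i i', forall j, P i j -> P i' j -> i = i'} ->
  \sum_(i <- s) \sum_(j <- r | P i j) F j <= \sum_(j <- r) F j.
Proof.
move=> us Pdisj; rewrite (exchange_big_dep predT) //=; apply: leq_sum => j _.
have [/hasP[i0 i0s Pi0]|/hasPn nP] := boolP (has (P^~ j) s); last first.
  by rewrite big_seq_cond big1 // => i /andP[/nP/negP].
rewrite big_mkcond /= (bigD1_seq i0) //= Pi0 big_seq_cond big1 ?addn0 // => i.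
case/andP=> iS /negP ni; case: ifP => // Pi; case: ni.
by apply/eqP; apply: Pdisj Pi Pi0.
Qed.

(** * Factors, branching and multiplicities of [x] *)

Section Language.
Variables (A : finType) (x : biword A).

Lemma size_factor_at i n : size (factor_at x i n) = n.
Proof. by rewrite size_map size_iota. Qed.

Lemma in_lang_factor_at i n : in_lang x (factor_at x i n).
Proof. by exists i; rewrite size_factor_at. Qed.

Lemma in_lang_cat u v : in_lang x (u ++ v) -> in_lang x u /\ in_lang x v.
Proof.
case=> i; rewrite size_cat factor_at_cat => /eqP.
rewrite eqseq_cat ?size_factor_at // => /andP[/eqP Eu /eqP Ev].
by split; [exists i | exists (i + (size u)%:Z)%R].
Qed.

Lemma in_lang_right_ext w b : in_lang x (rcons w b) -> b \in right_ext x w.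
Proof. by move=> h; rewrite inE; apply/asboolP. Qed.

Lemma right_ext_gt0 w : in_lang x w -> 0 < #|right_ext x w|.
Proof.
case=> i Ew; apply/card_gt0P; exists (x (i + (size w)%:Z)%R).
apply: in_lang_right_ext; exists i.
rewrite size_rcons -addn1 factor_at_cat -cats1 -Ew.
by rewrite /factor_at /= addr0.
Qed.

Definition words n : seq (seq A) := [seq tval t | t <- enum (lang_n x n)].

Lemma words_uniq n : uniq (words n).
Proof. by rewrite map_inj_uniq ?enum_uniq //; apply: val_inj. Qed.

Lemma wordsP n w : reflect (in_lang x w /\ size w = n) (w \in words n).
Proof.
apply: (iffP mapP) => [[t]|[wx /eqP sw]].
  by rewrite mem_enum inE => /asboolP tx ->; rewrite size_tuple.
by exists (Tuple sw) => //; rewrite mem_enum inE; apply/asboolP.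
Qed.

Lemma size_words n : size (words n) = complexity x n.
Proof. by rewrite size_map -cardE. Qed.

Lemma words_rcons n :
  perm_eq (words n.+1) [seq rcons w b | w <- words n, b <- enum (right_ext x w)].
Proof.
apply: uniq_perm; first exact: words_uniq.
  apply: allpairs_uniq_dep => [||[w b] [w' b'] _ _ /= /rcons_inj [-> ->]] //.
    exact: words_uniq.
  by move=> w _; apply: enum_uniq.
move=> w; apply/wordsP/allpairsPdep => [[wx sw]|[v [b [/wordsP[vx sv]]]]].
  case/lastP: w wx sw => // w b wbx /eqP; rewrite size_rcons eqSS => /eqP sw.
  exists w, b; split=> //; last by rewrite mem_enum; apply: in_lang_right_ext.
  by apply/wordsP; split=> //; move: wbx; rewrite -cats1 => /in_lang_cat[].
by rewrite mem_enum inE => /asboolP vbx ->; rewrite size_rcons sv.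
Qed.

Lemma words_cons n :
  perm_eq (words n.+1) [seq a :: w | w <- words n, a <- enum (left_ext x w)].
Proof.
apply: uniq_perm; first exact: words_uniq.
  apply: allpairs_uniq_dep => [||[w b] [w' b'] _ _ /= [-> ->]] //.
    exact: words_uniq.
  by move=> w _; apply: enum_uniq.
move=> w; apply/wordsP/allpairsPdep => [[wx sw]|[v [b [/wordsP[vx sv]]]]].
  case: w wx sw => // a w awx [sw]; exists w, a; split=> //.
    apply/wordsP; split=> //.
    by move: awx; rewrite -cat1s => /in_lang_cat[].
  by rewrite mem_enum inE; apply/asboolP.
by rewrite mem_enum inE => /asboolP vbx ->; rewrite /= sv.
Qed.

(** The truncated predecessor is exact on factors of [x], which always have a right extension. *)
Definition branching w := #|right_ext x w|.-1.

Lemma complexityS n :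
  complexity x n.+1 = complexity x n + \sum_(w <- words n) branching w.
Proof.
rewrite -!size_words (perm_size (words_rcons n)) size_allpairs_dep.
rewrite sumnE big_map -[size (words n)]sum1_size -big_split /=.
rewrite [LHS]big_seq [RHS]big_seq; apply: eq_bigr => w /wordsP[wx _].
by rewrite -cardE add1n prednK ?right_ext_gt0.
Qed.

Lemma card_bi_ext w :
  #|bi_ext x w| = \sum_(a in left_ext x w) #|right_ext x (a :: w)|.
Proof.
rewrite -sum1_card (eq_bigl (fun ab => (ab.1 \in left_ext x w) &&
    (ab.2 \in right_ext x (ab.1 :: w)))) => [|[a b] /=]; last first.
  rewrite !inE /=; apply/asboolP/andP => [abx|[_ /asboolP //]].
  split; apply/asboolP => //.
  by move: abx; rewrite -rcons_cons -cats1 => /in_lang_cat[].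
rewrite -(pair_big_dep (mem (left_ext x w))
  (fun a b => b \in right_ext x (a :: w)) (fun _ _ => 1)) /=.
by apply: eq_bigr => a _; rewrite sum1_card.
Qed.

Lemma multiplicityE w : in_lang x w ->
  multiplicity x w =
  ((\sum_(a <- enum (left_ext x w)) branching (a :: w))%N%:Z - (branching w)%:Z)%R.
Proof.
move=> wx; rewrite big_enum /multiplicity card_bi_ext.
have -> : \sum_(a in left_ext x w) #|right_ext x (a :: w)| =
    \sum_(a in left_ext x w) branching (a :: w) + #|left_ext x w|.
  rewrite -sum1_card -big_split /=; apply: eq_bigr => a.
  rewrite inE => /asboolP awx.
  by rewrite /branching addn1 prednK ?right_ext_gt0.
have -> : branching w = #|right_ext x w| - 1 by rewrite subn1.
rewrite PoszD -subzn ?right_ext_gt0 // opprB addrK addrA.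
by rewrite addrAC.
Qed.

(* The first difference of the complexity is a sequence of naturals that
   eventually does not increase, hence is eventually constant: the total
   multiplicity vanishes at large lengths, and so does each of its terms, as
   they all have the same sign. *)
Lemma weak_strong :
  eventually_weak_or_neutral x -> eventually_strong_or_neutral x.
Proof.
case=> N weakN.
pose s n := \sum_(w <- words n) branching w.
have le_ext w : in_lang x w -> N <= size w ->
    \sum_(a <- enum (left_ext x w)) branching (a :: w) <= branching w.
  move=> wx Nw; have := multiplicityE wx.
  by have := weakN w wx Nw; rewrite /weak /neutral; lia.
have sS n : s n.+1 =
    \sum_(w <- words n) \sum_(a <- enum (left_ext x w)) branching (a :: w).
  by rewrite /s (perm_big _ (words_cons n)) big_allpairs_dep.
(* The least value of [s] beyond [N], reached at [n0]: from there on [s] can neither go lower nor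
   rise. *)
have exv : exists v, `[< exists2 n, N <= n & s n = v >].
  by exists (s N); apply/asboolP; exists N.
case: (ex_minnP exv) => v /asboolP[n0 Nn0 sn0] minv.
have s_ge m : N <= m -> s n0 <= s m.
  by move=> Nm; rewrite sn0; apply: minv; apply/asboolP; exists m.
have sS_le n : N <= n -> s n.+1 <= s n.
  move=> Nn; rewrite sS /s [leqLHS]big_seq [leqRHS]big_seq.
  by apply: leq_sum => w /wordsP[wx sw]; rewrite le_ext ?sw.
have s_const n : n0 <= n -> s n = s n0.
  move=> n0n; apply/eqP; rewrite eqn_leq s_ge ?andbT; last exact: leq_trans n0n.
  rewrite -(subnK n0n); elim: (n - n0) => // k; apply: leq_trans.
  by apply: sS_le; rewrite (leq_trans Nn0) ?leq_addl.
exists n0 => w wx n0w; right; rewrite /neutral multiplicityE //.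
have Nw := leq_trans Nn0 n0w.
have ww : w \in words (size w) by apply/wordsP.
have := s_const _ (leqW n0w); rewrite -(s_const _ n0w) sS /s.
rewrite (bigD1_seq w) ?words_uniq //= [in RHS](bigD1_seq w) ?words_uniq //=.
have : \sum_(v <- words (size w) | v != w)
         \sum_(a <- enum (left_ext x v)) branching (a :: v) <=
       \sum_(v <- words (size w) | v != w) branching v.
  rewrite [leqLHS]big_seq_cond [leqRHS]big_seq_cond; apply: leq_sum => u.
  by case/andP=> /wordsP[ux su] _; rewrite le_ext ?su.
by have := le_ext w wx Nw; lia.
Qed.

(** Induction on [n - size w]: the bounds for the words [a :: w] are added up. *)
Lemma branching_le_sum N :
  (forall w, in_lang x w -> N <= size w -> strong x w \/ neutral x w) ->
  forall n w, in_lang x w -> N <= size w <= n ->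
  branching w <= \sum_(v <- words n | suffix w v) branching v.
Proof.
move=> strongN n w wx /andP[Nw /subnK]; move: (n - size w) => d En.
elim: d w En Nw wx => [|d IHd] w En Nw wx.
  have ww : w \in words n by apply/wordsP.
  by rewrite big_mkcond (bigD1_seq w) ?words_uniq //= suffix_refl leq_addr.
have -> : \sum_(v <- words n | suffix w v) branching v =
    \sum_(v <- [seq v <- words n | suffix w v]) branching v by rewrite big_filter.
apply: (@leq_trans (\sum_(a <- enum (left_ext x w)) branching (a :: w))).
  have := multiplicityE wx; have := strongN w wx Nw.
  by rewrite /strong /neutral; lia.
apply: leq_trans (@leq_sum_disjoint _ _ (enum (left_ext x w)) _
    (fun a v => suffix (a :: w) v) _ (enum_uniq _) _); last first.
  (* Only one letter precedes the suffix [w] of [v], so [v] determines [a]. *)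
  move=> a a' _ _ v /suffixP[u ->] /suffixP[u'] /eqP.
  rewrite -!cat_rcons; have [suu'|] := eqVneq (size u) (size u').
    rewrite eqseq_cat ?size_rcons ?suu' // => /andP[/eqP/rcons_inj[]] //.
  by move=> nsz /eqP/(congr1 size); rewrite !size_cat !size_rcons; lia.
rewrite [leqLHS]big_seq [leqRHS]big_seq; apply: leq_sum => a.
rewrite mem_enum inE => /asboolP awx.
apply: leq_trans (IHd (a :: w) _ _ awx) _ => /=; [lia|lia|].
rewrite big_filter_cond [leqRHS](eq_bigl (fun v => suffix (a :: w) v)) // => v.
apply/andP/idP=> [[]//|aw_v]; split=> //.
by apply: suffix_trans aw_v; rewrite -cat1s suffix_suffix.
Qed.

End Language.

(** * Covers of the factors of the image, and their growth *)

Section Covers.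
Variables (A B : finType) (x : biword A) (sigma : seq A -> seq B).
Hypotheses (sM : word_morphism sigma) (sN : non_erasing sigma).

Lemma size_morphism_cat u v :
  size (sigma (u ++ v)) = size (sigma u) + size (sigma v).
Proof. by rewrite sM.2 size_cat. Qed.

Lemma size_morphism_letter_gt0 a : 0 < size (sigma [:: a]).
Proof. by case: (sigma [:: a]) (sN (a := a)). Qed.

Lemma size_morphism_le w :
  size (sigma w) <= (\max_(a : A) size (sigma [:: a])) * size w.
Proof.
elim: w => [|a w IH]; first by rewrite sM.1.
rewrite -cat1s size_morphism_cat mulnS leq_add //.
exact: (leq_bigmax (F := fun a => size (sigma [:: a]))).
Qed.

Lemma morphism_split d w : d < size (sigma w) ->
  exists s1 a s2 k, [/\ w = s1 ++ a :: s2, d = size (sigma s1) + k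
    & k < size (sigma [:: a])].
Proof.
elim: w d => [|a w IH] d; first by rewrite sM.1.
rewrite -cat1s size_morphism_cat => lt_d.
have [lt_da|le_ad] := ltnP d (size (sigma [:: a])).
  by exists [::], a, w, d; rewrite sM.1.
have /IH[s1 [b [s2 [k [-> Ed lt_k]]]]] : d - size (sigma [:: a]) < size (sigma w).
  lia.
exists (a :: s1), b, s2, k; split=> //.
by rewrite -cat1s size_morphism_cat -addnA -Ed subnKC.
Qed.

Definition refine m (p : nat * seq A) : seq (nat * seq A) :=
  if size (sigma p.2) == m.+1 + p.1
  then [seq (p.1, rcons p.2 b) | b <- enum (right_ext x p.2)] else [:: p].

(* The pairs (k, w) for factors of length n = m.+1.  Going from n to n.+1, w is
   kept unless its image stops exactly at the end of the factor, in which case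
   it is replaced by its right extensions. *)
Fixpoint covers m : seq (nat * seq A) :=
  if m is m'.+1 then [seq q | p <- covers m', q <- refine m' p]
  else [seq (k, w) | w <- words x 1, k <- iota 0 (size (sigma w))].

(** A factor of length [m.+1] at offset [p.1] has its last letter at position [m + p.1]. The offset
    lies in the image of the first letter of [p.2]; the image of [p.2] reaches that position, but
    not without the last letter of [p.2]. *)
Definition minimal_cover m (p : nat * seq A) : Prop :=
  [/\ in_lang x p.2,
      size (sigma (behead p.2)) + p.1 < size (sigma p.2),
      m + p.1 < size (sigma p.2)
    & forall w b, p.2 = rcons w b -> size (sigma w) <= m + p.1].

Lemma coversP m p : p \in covers m -> minimal_cover m p.
Proof.
elim: m p => [|m IH] p.
  case/allpairsPdep=> w [k [/wordsP[wx sw]]].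
  rewrite mem_iota add0n /= => lt_k ->.
  case: w sw wx lt_k => [|a [|//]] //= _ ax lt_k.
  split=> //=; first by rewrite sM.1.
  by move=> [|? [|? ?]] // b [_]; rewrite sM.1.
case/allpairsPdep=> -[k w] [q [/IH[/= wx lt_beh lt_m le_m] qP ->]] {p}.
move: qP; rewrite /refine /=; case: eqP => [Ew|nEw]; last first.
  rewrite inE => /eqP->; split=> //= [|v b /le_m]; lia.
case/mapP=> b; rewrite mem_enum inE => /asboolP wbx ->.
(* As the image of [b] is nonempty, one more letter suffices for the longer factor. *)
have sb := size_morphism_letter_gt0 b.
split=> //=.
- case: w lt_beh {wx lt_m le_m Ew wbx} => [|a w] /=; first by rewrite ltnNge leq_addr.
  by rewrite -rcons_cons -!cats1 !size_morphism_cat; lia.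
- by rewrite -cats1 size_morphism_cat; lia.
by move=> v c /rcons_inj[<- _]; rewrite Ew.
Qed.

(** A word extended from [w] loses its last letter to give [w], whose image has length [m.+1 + k];
    minimality of a kept pair forbids this. So both pairs are kept or both extended. *)
Lemma refine_inj m p p' q : minimal_cover m p -> minimal_cover m p' ->
  q \in refine m p -> q \in refine m p' -> p = p'.
Proof.
case: p p' => [k w] [k' w'] [/= _ _ lt_w le_w] [/= _ _ lt_w' le_w'].
rewrite /refine /=; case: eqP => Ew; case: eqP => Ew'.
- by case/mapP=> b _ -> /mapP[b' _ [-> /rcons_inj[->]]].
- case/mapP=> b _ ->; rewrite inE => /eqP[Ek /esym/le_w']; lia.
- rewrite inE => /eqP-> /mapP[b _ [Ek /le_w]]; lia.
- by rewrite !inE => /eqP-> /eqP.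
Qed.

Lemma covers_uniq m : uniq (covers m).
Proof.
elim: m => [|m IH].
  apply: allpairs_uniq_dep => [||[w k] [w' k'] _ _ /= [-> ->]] //.
    exact: words_uniq.
  by move=> w _; apply: iota_uniq.
apply: allpairs_uniq_dep => //.
  move=> p _; rewrite /refine; case: ifP => // _.
  by rewrite map_inj_uniq ?enum_uniq // => b b' [/rcons_inj[]].
move=> _ _ /allpairsPdep[p [q [pm qp ->]]] /allpairsPdep[p' [q' [pm' qp' ->]]] /=.
move=> Eq; move: qp'; rewrite -Eq => qp'.
by rewrite (refine_inj (coversP pm) (coversP pm') qp qp').
Qed.

Lemma size_coversS m : size (covers m.+1) = size (covers m) +
  \sum_(p <- covers m | size (sigma p.2) == m.+1 + p.1) branching x p.2.
Proof.
rewrite /= size_allpairs_dep sumnE big_map -[size (covers m)]sum1_size.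
rewrite [X in _ + X]big_mkcond -big_split /=.
rewrite [LHS]big_seq [RHS]big_seq; apply: eq_bigr => p /coversP[px _ _ _].
rewrite /refine; case: ifP => // _.
by rewrite size_map -cardE add1n prednK ?right_ext_gt0.
Qed.

(** Of two suffixes of [v], one is a suffix of the other. A proper suffix of [p'.2] has an image
    shorter than [m.+1], since the offset lies in the first letter's image, whereas the image of
    [p.2] has length at least [m.+1]. *)
Lemma covers_suffix_free m p p' v : p \in covers m -> p' \in covers m ->
  size (sigma p.2) == m.+1 + p.1 -> size (sigma p'.2) == m.+1 + p'.1 ->
  suffix p.2 v -> suffix p'.2 v -> p = p'.
Proof.
wlog le_pp' : p p' / size p.2 <= size p'.2 => [IH|].
  case/orP: (leq_total (size p.2) (size p'.2)) => [/IH|/IH{}IH] // *.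
  by apply/esym; apply: IH.
move=> /coversP[_ _ _ _] /coversP[_ lt_p' _ _] /eqP Ep /eqP Ep' pv p'v.
have : suffix p.2 p'.2.
  move: pv p'v; rewrite !suffixE => /eqP {2}<- /eqP <-.
  by rewrite size_drop drop_drop; apply/eqP; congr drop; lia.
case: p p' Ep Ep' lt_p' {le_pp' pv p'v} => [k w] [k' w'] /= Ew Ew' lt_w'.
case/suffixP=> -[|a u] Eu; move: Ew' lt_w'; rewrite Eu /=.
  by rewrite Ew => /eqP; rewrite eqn_add2l => /eqP->.
by rewrite size_morphism_cat; lia.
Qed.

Lemma size_covers_growth N m :
  (forall w, in_lang x w -> N <= size w -> strong x w \/ neutral x w) ->
  (\max_(a : A) size (sigma [:: a])) * N <= m ->
  size (covers m.+1) + complexity x m.+1 <=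
  size (covers m) + complexity x m.+2.
Proof.
move=> strongN le_m; rewrite size_coversS (complexityS x m.+1).
rewrite -addnA leq_add2l addnC leq_add2l.
set P := fun p : nat * seq A => size (sigma p.2) == m.+1 + p.1.
rewrite -big_filter.
apply: leq_trans (@leq_sum_disjoint _ _ [seq p <- covers m | P p] _
    (fun p v => suffix p.2 v) _ _ _); last first.
- move=> p p'; rewrite !mem_filter => /andP[Pp pm] /andP[Pp' pm'] v pv p'v.
  exact: (covers_suffix_free pm pm' Pp Pp' pv p'v).
- by rewrite filter_uniq ?covers_uniq.
rewrite [leqLHS]big_seq [leqRHS]big_seq; apply: leq_sum => p.
rewrite mem_filter => /andP[/eqP Ep /coversP[px lt_p _ _]].
apply: (branching_le_sum strongN px); apply/andP; split.
  (* Fewer than [N] letters would give an image of length at most [m]. *)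
  have := size_morphism_le p.2; rewrite Ep => le_p.
  rewrite leqNgt; apply/negP => lt_N.
  suff /(leq_trans le_p) : (\max_(a : A) size (sigma [:: a])) * size p.2 <= m.
    by rewrite addSn ltnNge leq_addr.
  by apply: leq_trans le_m; rewrite leq_mul2l (ltnW lt_N) orbT.
(* Without its first letter, [p.2] has an image of length at most [m], hence at most [m] letters. *)
move: lt_p; rewrite Ep ltn_add2r; apply: leq_trans.
apply: leq_trans (leqSpred _) _; rewrite ltnS -size_behead.
exact: leq_size_morphism.
Qed.

(** * Every factor of the image is read off a cover *)

Lemma covers_factor_at m i k : k < size (sigma [:: x i]) ->
  exists r, (k, factor_at x i r) \in covers m.
Proof.
move=> lt_k; elim: m => [|m [r IH]].
  have E1 : factor_at x i 1 = [:: x i] by rewrite /factor_at /= addr0.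
  exists 1; apply/allpairsPdep; exists (factor_at x i 1), k; split=> //.
    by apply/wordsP; split; [apply: in_lang_factor_at | rewrite size_factor_at].
  by rewrite E1 mem_iota.
have [Er|nEr] := eqVneq (size (sigma (factor_at x i r))) (m.+1 + k).
  have Erc : factor_at x i r.+1 = rcons (factor_at x i r) (x (i + r%:Z)%R).
    by rewrite -addn1 factor_at_cat -cats1 /factor_at /= addr0.
  (* The image is exhausted: among the right extensions, follow the next letter of [x]. *)
  exists r.+1; apply/allpairsPdep; exists (k, factor_at x i r), (k, factor_at x i r.+1).
  split=> //; rewrite /refine /= Er eqxx Erc; apply: map_f; rewrite mem_enum.
  by apply: in_lang_right_ext; rewrite -Erc; apply: in_lang_factor_at.
exists r; apply/allpairsPdep; exists (k, factor_at x i r), (k, factor_at x i r).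
by split=> //; rewrite /refine /= (negPf nEr) inE.
Qed.

(** One image is a prefix of the other. *)
Lemma take_drop_factor_at n k i r r' :
  n + k <= size (sigma (factor_at x i r)) ->
  n + k <= size (sigma (factor_at x i r')) ->
  take n (drop k (sigma (factor_at x i r))) =
  take n (drop k (sigma (factor_at x i r'))).
Proof.
wlog le_rr' : r r' / r <= r' => [IH|].
  case/orP: (leq_total r r') => [/IH|/IH{}IH] // *.
  by apply/esym; apply: IH.
move=> le_r _; rewrite -(subnKC le_rr') factor_at_cat sM.2.
rewrite drop_cat; case: ltnP => lt_k.
  by rewrite takel_cat // size_drop; lia.
have -> : n = 0 by lia.
by rewrite !take0.
Qed.

Lemma in_lang_bi_image j m : exists i k r,
  [/\ k < size (sigma [:: x i]), m.+1 + k <= size (sigma (factor_at x i r))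
    & factor_at (bi_image sM sN x) j m.+1 =
      take m.+1 (drop k (sigma (factor_at x i r)))].
Proof.
(* As [sigma] does not shorten words, the image of [x] from [- M] to [n - 1] contains positions [j]
   to [j + m]. *)
pose M := `|j|%N; pose n := M + m.+1.
have := bi_imageE sM sN x M n; set s := sigma _; set D := size _ => /= Es.
have le_MD : M <= D by apply: leq_size_image.
have le_s : D + n <= size s.
  by rewrite /s factor_at_cat size_morphism_cat leq_add2l; apply: leq_size_image.
(* The position [j] counted from the start of [s]; nonnegative because [M <= D]. *)
pose d := `|(j + D%:Z)%R|%N.
have Ed : (- D%:Z + d%:Z = j)%R by lia.
have le_ds : d + m.+1 <= size s by lia.
have Eu : factor_at (bi_image sM sN x) j m.+1 = take m.+1 (drop d s).
  rewrite Es -(subnKC le_ds) -addnA factor_at_cat drop_size_cat ?size_factor_at //.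
  by rewrite Ed factor_at_cat take_size_cat ?size_factor_at.
have lt_ds : d < size (sigma (factor_at x (- M%:Z)%R (M + n))) by rewrite -/s; lia.
have [s1 [a [s2 [k [Ef Edk lt_k]]]]] := morphism_split lt_ds.
have [Es1 Eas2] : s1 = factor_at x (- M%:Z)%R (size s1) /\
    a :: s2 = factor_at x (- M%:Z + (size s1)%:Z)%R (size s2).+1.
  have := congr1 size Ef; rewrite size_factor_at size_cat /= => Esz.
  move: Ef; rewrite Esz factor_at_cat => /esym/eqP.
  by rewrite eqseq_cat ?size_factor_at // => /andP[/eqP<- /eqP].
have Ea : a = x (- M%:Z + (size s1)%:Z)%R.
  by move: Eas2; rewrite -addn1 addnC factor_at_cat /factor_at /= addr0 => -[].
exists (- M%:Z + (size s1)%:Z)%R, k, (size s2).+1.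
rewrite -Ea -Eas2; split=> //.
  by move: le_ds; rewrite /s Ef size_morphism_cat Edk; lia.
by rewrite Eu /s Ef sM.2 Edk drop_cat ltnNge leq_addr /= addKn.
Qed.

Lemma complexity_bi_image_le m :
  complexity (bi_image sM sN x) m.+1 <= size (covers m).
Proof.
rewrite -size_words -(size_map (fun p => take m.+1 (drop p.1 (sigma p.2)))).
apply: uniq_leq_size => [|u /wordsP[[j Eu] su]]; first exact: words_uniq.
rewrite Eu su.
have [i [k [r [lt_k le_r ->]]]] := in_lang_bi_image j m.
have [r' kr'] := covers_factor_at m lt_k.
have [_ _ /= lt_r' _] := coversP kr'.
apply/mapP; exists (k, factor_at x i r') => //=.
exact: take_drop_factor_at.
Qed.

End Covers.

Theorem theorem13 (A B : finType) (hA : 1 < #|A|) (hB : 1 < #|B|)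
  (x : biword A)
  (hx : eventually_weak_or_neutral x \/ eventually_strong_or_neutral x)
  (sigma : seq A -> seq B)
  (sM : word_morphism sigma) (sN : non_erasing sigma) :
  exists C : int, forall n : nat,
    ((complexity (bi_image sM sN x) n)%:Z <= C + (complexity x n)%:Z)%R.
Proof.
have [N strongN] : eventually_strong_or_neutral x.
  by case: hx => // /weak_strong.
pose m0 := (\max_(a : A) size (sigma [:: a])) * N.
pose c m := size (covers x sigma m).
have c_nondec m d : c m <= c (m + d).
  elim: d => [|d IHd]; first by rewrite addn0.
  by apply: leq_trans IHd _; rewrite addnS /c (size_coversS x sM sN) leq_addr.
(* Telescoping: from [m0] on, [c m] minus the complexity at [m.+1] does not increase. *)
have growth d : c (m0 + d) <= c m0 + complexity x (m0 + d).+1.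
  elim: d => [|d IHd]; first by rewrite addn0 leq_addr.
  have := size_covers_growth sM sN strongN (leq_addr d m0).
  by rewrite -/(c _) -/(c (m0 + d)) addnS; lia.
(* The extra 1 pays for length 0, where the empty word is the only one. *)
exists (c m0).+1%:Z%R => -[|m]; rewrite -PoszD lez_nat.
  apply: leq_trans (max_card _) _.
  by rewrite card_tuple expn0 addSn.
apply: leq_trans (complexity_bi_image_le x sM sN m) _; rewrite -/(c m).
case: (leqP m0 m) => [le_m|/ltnW le_m].
  by rewrite -(subnKC le_m) addSn leqW // growth.
apply: leq_trans (leq_addr _ _); rewrite leqW // -(subnKC le_m).
exact: c_nondec.
Qed.
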